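(* For every integer $k \geq 8$, $$\frac{k}{k-1} \cdot 3^{k-1} + 3^{k-2} \;\leq\; h(3,k) \;\leq\; \frac{k}{k-1} \cdot 3^{k-1} + 3^{k-\frac{3}{2}} .$$
   Context: For positive integers $n, k$, let $P(n,k) := \{0,1,\dots,n-1\}^k$, a set of $n^k$ points in $\mathbb{R}^k$. A covering trail for a finite set $S \subset \mathbb{R}^k$ is a polygonal chain in $\mathbb{R}^k$ (a sequence of straight line segments, called edges or links, each consecutive pair sharing an endpoint: $V_0V_1, V_1V_2, \dots, V_{m-1}V_m$ with $V_j \in \mathbb{R}^k$) whose union contains every point of $S$. The vertices $V_j$ are arbitrary points of $\mathbb{R}^k$ (not necessarily points of $S$), the edges need not be axis-parallel, and points of $S$ may be visited more than once. The link-length of the chain is its number $m$ of edges. $h(n,k)$ denotes the minimum link-length of a covering trail for $P(n,k)$. *)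

(* Defs.v *)
From mathcomp Require Import all_boot all_order all_algebra.
From mathcomp Require Import all_classical all_reals all_analysis.

Set Implicit Arguments.
Unset Strict Implicit.
Unset Printing Implicit Defensive.

Import Order.TTheory GRing.Theory Num.Theory.

Local Open Scope classical_set_scope.
Local Open Scope ring_scope.

(* P(n, k) = {0, ..., n-1}^k as a subset of R^k. *)
Definition grid (R : realType) (n k : nat) : set 'rV[R]_k :=
  range (fun f : {ffun 'I_k -> 'I_n} => \row_(j < k) (f j)%:R).
Arguments grid : clear implicits.

Definition segment (R : realType) (k : nat) (a b : 'rV[R]_k) : set 'rV[R]_k :=
  [set (1 - t) *: a + t *: b | t in `[0, 1]].

(* A polygonal chain with m edges is given by its m + 1 vertices V_0, ..., V_m;
   the i-th edge joins V_i and V_(i+1). *)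
Definition chain_support (R : realType) (k m : nat)
    (V : 'I_m.+1 -> 'rV[R]_k) : set 'rV[R]_k :=
  \bigcup_(i in [set: 'I_m]) segment (V (widen_ord (leqnSn m) i)) (V (lift ord0 i)).

Definition covering_trail (R : realType) (k m : nat) (S : set 'rV[R]_k)
    (V : 'I_m.+1 -> 'rV[R]_k) : Prop :=
  S `<=` chain_support V.

Definition has_covering_trail (R : realType) (n k m : nat) : Prop :=
  exists V : 'I_m.+1 -> 'rV[R]_k, covering_trail (grid R n k) V.

(* Joining all the points of the grid one after the other gives a trail. *)
Lemma ex_covering_trail (R : realType) (n k : nat) :
  exists m, `[< has_covering_trail R n k m >].
Proof.
pose pt (f : {ffun 'I_k -> 'I_n}) : 'rV[R]_k := \row_(j < k) (f j)%:R.
pose s := [seq pt f | f <- enum {ffun 'I_k -> 'I_n}].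
exists (size s); apply/asboolP.
exists (fun i => nth 0 s i) => _ [f _ <-].
have fs : (index (pt f) s < size s)%N.
  by rewrite index_mem; apply/mapP; exists f => //; rewrite mem_enum.
exists (Ordinal fs) => //; exists 0; first by rewrite /= in_itv /= lexx ler01.
by rewrite subr0 scale1r scale0r addr0 /= nth_index // -index_mem.
Qed.

(* h(n, k): the minimum link-length of a covering trail for P(n, k). *)
Definition h (R : realType) (n k : nat) : nat :=
  ex_minn (ex_covering_trail R n k).

(* Main.v *)
Require Import Defs.
From mathcomp Require Import all_boot all_order all_algebra.
From mathcomp Require Import all_classical all_reals all_analysis.
From mathcomp Require Import zify ring lra.

Import Order.TTheory GRing.Theory Num.Theory.

Local Open Scope ring_scope.

(**
  Lower bound: a trail with m edges covers at most 2m + 1 points of {0,1,2}^k,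
  so that h(3,k) >= (3^k - 1)/2. An edge covers at most 3 points, so it is
  enough that between two edges covering 3 new points each there is an edge
  covering at most 1 new point. If not, then two consecutive edges in this range
  share a vertex outside the grid and have two points each on their rays from
  this vertex. This forces the vertex to have integer coordinates, so it reduces
  mod 3 to a grid point. Mod 3, an edge with two grid points p, q becomes the
  line {p, q, -(p+q)} of F_3^k, which contains the reductions of both its ends.
  Hence along the edges between the two full ones, walking backwards, the
  reduction of the vertex does not change until it is itself a point of an edge;
  so it is always a point first covered by a later edge. But a full edge is a
  whole line of F_3^k, so the first of the two full edges contains the
  reduction of its end: a contradiction.

  Upper bound: a trail with 13 edges for {0,1,2}^3, and h(3,k+1) <= 3 h(3,k) + 2,
  give h(3,k) <= 14 * 3^(k-3) - 1; the claim follows from 5/3 <= sqrt 3.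
*)

Set Implicit Arguments.
Unset Strict Implicit.
Unset Printing Implicit Defensive.

(** * Grid points, lines and reduction mod 3 *)

Definition grid_point (R : realType) (k : nat) (f : {ffun 'I_k -> 'I_3}) :
  'rV[R]_k := \row_j (f j)%:R.
Arguments grid_point R {k} f.

Definition edge_points (R : realType) (k : nat) (a b : 'rV[R]_k) :
  {set {ffun 'I_k -> 'I_3}} := [set f | `[< segment a b (grid_point R f) >]].

(** For [r > 0] and [p != q] the points lie on the line in the order [v], [p], [q]. *)
Definition on_line (R : realType) (k : nat) (v : 'rV[R]_k)
    (p q : {ffun 'I_k -> 'I_3}) (r : R) : Prop :=
  forall i, v 0 i = (p i)%:R + r * ((p i)%:R - (q i)%:R).

(** The point -(p + q) that completes the line of F_3^k through [p] and [q]; the factor 2 is -1 mod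
    3. *)
Definition third (k : nat) (p q : {ffun 'I_k -> 'I_3}) : {ffun 'I_k -> 'I_3} :=
  [ffun i => inord ((2 * (p i + q i)) %% 3)%N].

(** Integrality of [v] is part of the notion; [g] represents its class mod 3 by the digits 0, 1,
    2. *)
Definition reduces_to (R : realType) (k : nat) (v : 'rV[R]_k)
    (g : {ffun 'I_k -> 'I_3}) : Prop :=
  forall i, exists w : int, v 0 i = (g i)%:R + 3 * w%:~R.

Lemma third_val (k : nat) (p q : {ffun 'I_k -> 'I_3}) i :
  third p q i = ((2 * (p i + q i)) %% 3)%N :> nat.
Proof. by rewrite ffunE inordK // ltn_mod. Qed.

Lemma natI3_eq (R : realType) (a b : 'I_3) : (a%:R == b%:R :> R) = (a == b).
Proof. by rewrite eqr_nat. Qed.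

(** * Grid points on a single edge *)

Lemma edge_pointsP (R : realType) (k : nat) (a b : 'rV[R]_k)
    (f : {ffun 'I_k -> 'I_3}) :
  reflect (exists t, [/\ 0 <= t, t <= 1 &
             forall i, (f i)%:R = (1 - t) * a 0 i + t * b 0 i])
          (f \in edge_points a b).
Proof.
rewrite inE; apply: (iffP (asboolP _)) => [[t]|[t [t0 t1 E]]].
  rewrite /= in_itv /= => /andP[t0 t1] E; exists t; split=> // i.
  by move/rowP/(_ i): E; rewrite !mxE.
exists t; first by rewrite /= in_itv /= t0.
by apply/rowP => i; rewrite !mxE E.
Qed.

Lemma segmentC (R : realType) (k : nat) (a b : 'rV[R]_k) x :
  segment a b x -> segment b a x.
Proof.
case=> t; rewrite /= in_itv /= => /andP[t0 t1] <-; exists (1 - t).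
  by rewrite /= in_itv /= subr_ge0 t1 gerBl.
by rewrite subKr addrC.
Qed.

Lemma edge_pointsC (R : realType) (k : nat) (a b : 'rV[R]_k) :
  edge_points a b = edge_points b a.
Proof.
by apply/setP => f; rewrite !inE; apply/asboolP/asboolP; apply: segmentC.
Qed.

Lemma on_line_of_edge_points (R : realType) (k : nat) (v b : 'rV[R]_k) p q :
    p \in edge_points v b -> q \in edge_points v b -> p != q ->
  exists r, on_line v p q r.
Proof.
move=> /edge_pointsP[s [s0 s1 Ep]] /edge_pointsP[t [t0 t1 Eq]] npq.
have nst : t - s != 0.
  apply: contraNneq npq => st; have {st} st : t = s by lra.
  apply/eqP/ffunP => i; apply/eqP.
  by rewrite -(natI3_eq R) Ep Eq st.
by exists (s / (t - s)) => i; rewrite Ep Eq; field.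
Qed.

(** Since [v] is an end of the edge and no grid point, both points lie strictly on one side of it;
    the nearer one comes first in [on_line]. *)
Lemma ray_of_edge_points (R : realType) (k : nat) (v b : 'rV[R]_k) p q :
    (forall g, v != grid_point R g) ->
    p \in edge_points v b -> q \in edge_points v b -> p != q ->
  exists2 r, 0 < r & on_line v p q r \/ on_line v q p r.
Proof.
move=> nv; wlog: p q / exists s t : R, [/\ 0 <= s, s <= t,
  forall i, (p i)%:R = (1 - s) * v 0 i + s * b 0 i &
  forall i, (q i)%:R = (1 - t) * v 0 i + t * b 0 i].
  move=> H Hp Hq npq.
  have /edge_pointsP[s [s0 s1 Ep]] := Hp.
  have /edge_pointsP[t [t0 t1 Eq]] := Hq.
  have [st|ts] := leP s t.
    by apply: H => //; exists s, t; split.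
  have [||//||r r0 [Hl|Hl]] := H q p; rewrite 1?eq_sym //.
  - by exists t, s; split=> //; apply: ltW.
  - by exists r => //; right.
  - by exists r => //; left.
move=> [s [t [s0 st Ep Eq]]] _ _ npq.
have ns : s != 0.
  apply: contraNneq (nv p) => s00; apply/eqP/rowP => i.
  by rewrite mxE Ep s00; ring.
have nst : t - s != 0.
  apply: contraNneq npq => ts; have {ts} ts : t = s by lra.
  by apply/eqP/ffunP => i; apply/eqP; rewrite -(natI3_eq R) Ep Eq ts.
exists (s / (t - s)).
  by rewrite divr_gt0 // lt0r ?ns ?nst // subr_ge0.
by left=> i; rewrite Ep Eq; field.
Qed.

Lemma edge_points_coord_inj (R : realType) (k : nat) (a b : 'rV[R]_k) p q i :
    a 0 i != b 0 i -> p \in edge_points a b -> q \in edge_points a b ->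
  p i = q i -> p = q.
Proof.
move=> nab /edge_pointsP[s [s0 s1 Ep]] /edge_pointsP[t [t0 t1 Eq]] pq.
have st : s = t.
  have E : (s - t) * (b 0 i - a 0 i) = 0.
    have := Ep i; rewrite pq Eq => E; lra.
  move/eqP: E; rewrite mulf_eq0 !subr_eq0 => /orP[/eqP//|].
  by rewrite eq_sym (negbTE nab).
by apply/ffunP => j; apply/eqP; rewrite -(natI3_eq R) Ep Eq st.
Qed.

Lemma edge_points_separated (R : realType) (k : nat) (a b : 'rV[R]_k) p q :
    p \in edge_points a b -> q \in edge_points a b -> p != q ->
  exists i, a 0 i != b 0 i.
Proof.
move=> /edge_pointsP[s [s0 s1 Ep]] /edge_pointsP[t [t0 t1 Eq]] npq.
have [/existsP//|/existsPn ab] := boolP [exists i, a 0 i != b 0 i].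
case/negP: npq; apply/eqP/ffunP => i; apply/eqP; rewrite -(natI3_eq R) Ep Eq.
by have /negPn/eqP -> := ab i; apply/eqP; ring.
Qed.

(** A coordinate in which the ends differ determines the point of the edge, and takes only three
    values on the grid. *)
Lemma card_edge_points (R : realType) (k : nat) (a b : 'rV[R]_k) :
  (#|edge_points a b| <= 3)%N.
Proof.
rewrite leqNgt; apply/negP => lt3.
have /card_gt1P[p [q [Hp Hq npq]]] : (1 < #|edge_points a b|)%N by lia.
have [i nab] := edge_points_separated Hp Hq npq.
suff : (#|edge_points a b| <= #|'I_3|)%N by rewrite card_ord; lia.
apply: (@leq_card_in _ _ (fun f : {ffun 'I_k -> 'I_3} => f i)) => x y Hx Hy.
exact: (edge_points_coord_inj nab).
Qed.

(** In a coordinate that varies, the three points take the values 0, 1, 2, so the one with value 1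
    is the midpoint of the other two; mod 3, half of p + q is 2(p + q). *)
Lemma edge_points3 (R : realType) (k : nat) (a b : 'rV[R]_k) :
    (2 < #|edge_points a b|)%N ->
  exists p q, [/\ p != q, p \in edge_points a b, q \in edge_points a b &
                  third p q \in edge_points a b].
Proof.
move=> gt2.
have /card_gt1P[p' [q' [Hp' Hq' npq']]] : (1 < #|edge_points a b|)%N by lia.
have [i nab] := edge_points_separated Hp' Hq' npq'.
have inj : {in edge_points a b &, injective (fun f : {ffun _ -> 'I_3} => f i)}.
  by move=> x y; apply: edge_points_coord_inj.
have full : [set f i | f : {ffun _ -> 'I_3} in edge_points a b] = [set: 'I_3]%SET.
  by apply/eqP; rewrite eqEcard finset.subsetT cardsT card_ord card_in_imset.
have get (c : 'I_3) : exists2 f, f \in edge_points a b & f i = c.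
  by have := finset.in_setT c; rewrite -full => /imsetP[f ? ?]; exists f.
have [p Hp p0] := get (inord 0).
have [x Hx x1] := get (inord 1).
have [q Hq q2] := get (inord 2).
exists p, q; split=> //.
  by apply/eqP => pq; move: q2; rewrite -pq p0 => /(congr1 (@nat_of_ord 3)); rewrite !inordK.
suff <- : x = third p q by [].
have /edge_pointsP[s [_ _ Ep]] := Hp.
have /edge_pointsP[t [_ _ Eq]] := Hq.
have /edge_pointsP[u [_ _ Ex]] := Hx.
have E2u : 2 * u = s + t.
  have := Ep i; have := Eq i; have := Ex i; rewrite p0 x1 q2 !inordK // => e1 e2 e0.
  have E : (2 * u - s - t) * (b 0 i - a 0 i) = 0 by lra.
  move/eqP: E; rewrite mulf_eq0 (subr_eq0 (b 0 i)) [b 0 i == _]eq_sym (negbTE nab).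
  by rewrite orbF => /eqP; lra.
apply/ffunP => j; apply/val_inj; rewrite /= third_val.
have E : (2 * x j)%:R = (p j + q j)%:R :> R.
  rewrite natrM natrD Ep Eq Ex.
  have -> : s = 2 * u - t by lra.
  by ring.
have {E} <- : (2 * x j = p j + q j)%N by apply/eqP; rewrite -(eqr_nat R) E.
by case: (x j) => c c3 /=; lia.
Qed.

(** * Reductions of points on a line and of vertices *)

(** Where [p] and [q] differ, they differ by 1 or 2, so 2r is an integer N. Then 2g = 2p + N(p - q)
    mod 3, and the residues 0, 1, 2 of N give [p], [q], [third p q]. *)
Lemma reduces_to_on_line (R : realType) (k : nat) (v : 'rV[R]_k) g p q r :
    reduces_to v g -> p != q -> on_line v p q r ->
  [\/ g = p, g = q | g = third p q].
Proof.
move=> vg npq vpq.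
have [i0 npq0] : exists i, p i != q i.
  apply/existsP; rewrite -negb_forall; apply: contraNN npq => /forallP pq.
  by apply/eqP/ffunP => i; apply/eqP.
have [N EN] : exists N : int, 2 * r = N%:~R.
  have [w] := vg i0; rewrite (vpq i0).
  move: npq0; case: (p i0) => [[|[|[|//]]] ?]; case: (q i0) => [[|[|[|//]]] ?] //= _;
    move: (g i0) => gi E.
  - exists (- 2 * (gi%:Z + 3 * w)); rewrite !(rmorphM, rmorphD, rmorphN) /=; lra.
  - exists (- (gi%:Z + 3 * w)); rewrite !(rmorphM, rmorphD, rmorphN) /=; lra.
  - exists (2 * (gi%:Z + 3 * w - 1)); rewrite !(rmorphM, rmorphD, rmorphN) /=; lra.
  - exists (- 2 * (gi%:Z + 3 * w - 1)); rewrite !(rmorphM, rmorphD, rmorphN) /=; lra.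
  - exists (gi%:Z + 3 * w - 2); rewrite !(rmorphM, rmorphD, rmorphN) /=; lra.
  - exists (2 * (gi%:Z + 3 * w - 2)); rewrite !(rmorphM, rmorphD, rmorphN) /=; lra.
have coord i : exists w : int,
    2 * (g i)%:Z + 3 * w = 2 * (p i)%:Z + N * ((p i)%:Z - (q i)%:Z).
  have [w E] := vg i; exists (2 * w); apply/eqP; rewrite -(eqr_int R).
  rewrite !(rmorphM, rmorphD, rmorphN) /= -EN.
  by have := vpq i; rewrite E => E'; apply/eqP; lra.
have [M [EM|EM|EM]] : exists M : int, [\/ N = 3 * M, N = 3 * M + 1 | N = 3 * M + 2].
  exists (N %/ 3)%Z; have : N = 3 * (N %/ 3)%Z + (N %% 3)%Z by lia.
  have [|[|]] : (N %% 3)%Z = 0 \/ (N %% 3)%Z = 1 \/ (N %% 3)%Z = 2 by lia.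
  - by move=> -> ->; rewrite addr0; constructor 1; lia.
  - by move=> -> E; constructor 2; lia.
  - by move=> -> E; constructor 3; lia.
- constructor 1; apply/ffunP => i; apply/ord_inj; have [w] := coord i.
  have -> : N * ((p i)%:Z - (q i)%:Z) = 3 * (M * ((p i)%:Z - (q i)%:Z)) by rewrite EM; ring.
  move: (M * _) => X.
  case: (g i) => a a3; case: (p i) => b b3; case: (q i) => c c3 /=; lia.
- constructor 2; apply/ffunP => i; apply/ord_inj; have [w] := coord i.
  have -> : N * ((p i)%:Z - (q i)%:Z) =
      3 * (M * ((p i)%:Z - (q i)%:Z)) + ((p i)%:Z - (q i)%:Z) by rewrite EM; ring.
  move: (M * _) => X.
  case: (g i) => a a3; case: (p i) => b b3; case: (q i) => c c3 /=; lia.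
- constructor 3; apply/ffunP => i; apply/ord_inj; have [w] := coord i.
  have -> : N * ((p i)%:Z - (q i)%:Z) =
      3 * (M * ((p i)%:Z - (q i)%:Z)) + 2 * ((p i)%:Z - (q i)%:Z) by rewrite EM; ring.
  rewrite third_val; move: (M * _) => X.
  case: (g i) => a a3; case: (p i) => b b3; case: (q i) => c c3 /=; lia.
Qed.

(* The equalities paired with the relations between r and s do not depend on the
   coordinate: two lines meeting with r, s <> 1 share a grid point. *)
Lemma crossing_coord (R : realFieldType) (r s : R) (a b c d : 'I_3) :
    0 < r -> 0 < s -> r != 1 -> s != 1 ->
    a%:R + r * (a%:R - b%:R) = c%:R + s * (c%:R - d%:R) :> R ->
  [/\ a = b, c = d & a = c] \/
  [\/ [\/ s = r /\ (a = c /\ b = d), s = 1 + r /\ b = c | r = 1 + s /\ a = d],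
      s = 1 + 2 * r /\ b = d, r = 1 + 2 * s /\ b = d |
      s = 2 * r /\ a = c \/ r = 2 * s /\ a = c].
Proof.
move=> r0 s0 /eqP r1 /eqP s1.
case: a => [[|[|[|//]]] ?]; case: b => [[|[|[|//]]] ?];
  case: c => [[|[|[|//]]] ?]; case: d => [[|[|[|//]]] ?] /= E;
  first [ by left; split; apply/val_inj
        | exfalso; first [lra | apply: r1; lra | apply: s1; lra]
        | right; first
          [ by constructor 1; constructor 1; split; [lra | split; apply/val_inj]
          | by constructor 1; constructor 2; split; [lra | apply/val_inj]
          | by constructor 1; constructor 3; split; [lra | apply/val_inj]
          | by constructor 2; split; [lra | apply/val_inj]
          | by constructor 3; split; [lra | apply/val_inj]
          | by constructor 4; left; split; [lra | apply/val_inj]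
          | by constructor 4; right; split; [lra | apply/val_inj]]].
Qed.

(** Otherwise a coordinate separating [p] from [q] fixes a relation between [r] and [s]. Relations
    paired with different equalities exclude each other, so one equality holds in all coordinates
    and the two pairs share a point. *)
Lemma crossing_ratio (R : realType) (k : nat) (v : 'rV[R]_k) p q p' q' (r s : R) :
    0 < r -> 0 < s -> on_line v p q r -> on_line v p' q' s ->
    p != q -> p != p' -> p != q' -> q != p' -> q != q' ->
  r = 1 \/ s = 1.
Proof.
move=> r0 s0 vpq vpq' npq npp' npq' nqp' nqq'.
have [->|r1] := eqVneq r 1; first by left.
have [->|s1] := eqVneq s 1; first by right.
have coord i := crossing_coord r0 s0 r1 s1 (etrans (esym (vpq i)) (vpq' i)).
have [i0 npq0] : exists i, p i != q i.
  apply/existsP; rewrite -negb_forall; apply: contraNN npq => /forallP pq.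
  by apply/eqP/ffunP => i; apply/eqP.
move/eqP: r1 => r1; move/eqP: s1 => s1.
have [[pq0]|] := coord i0; first by rewrite pq0 eqxx in npq0.
case=> [[[E _]|[E _]|[E _]]|[E _]|[E _]|[[E _]|[E _]]].
- case/eqP: npp'; apply/ffunP => i.
  case: (coord i) => [[-> _ <-]//|].
  by case=> [[[F [G H]]|[F G]|[F G]]|[F G]|[F G]|[[F G]|[F G]]] //; exfalso; lra.
- case/eqP: nqp'; apply/ffunP => i.
  case: (coord i) => [[<- _ <-]//|].
  case=> [[[F [G H]]|[F G]|[F G]]|[F G]|[F G]|[[F G]|[F G]]] //; exfalso;
    first [lra | apply: r1; lra | apply: s1; lra].
- case/eqP: npq'; apply/ffunP => i.
  case: (coord i) => [[_ <- <-]//|].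
  case=> [[[F [G H]]|[F G]|[F G]]|[F G]|[F G]|[[F G]|[F G]]] //; exfalso;
    first [lra | apply: r1; lra | apply: s1; lra].
- case/eqP: nqq'; apply/ffunP => i.
  case: (coord i) => [[<- <- <-]//|].
  case=> [[[F [G H]]|[F G]|[F G]]|[F G]|[F G]|[[F G]|[F G]]] //; exfalso;
    first [lra | apply: r1; lra | apply: s1; lra].
- case/eqP: nqq'; apply/ffunP => i.
  case: (coord i) => [[<- <- <-]//|].
  case=> [[[F [G H]]|[F G]|[F G]]|[F G]|[F G]|[[F G]|[F G]]] //; exfalso;
    first [lra | apply: r1; lra | apply: s1; lra].
- case/eqP: npp'; apply/ffunP => i.
  case: (coord i) => [[_ _ <-]//|].
  case=> [[[F [G H]]|[F G]|[F G]]|[F G]|[F G]|[[F G]|[F G]]] //; exfalso;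
    first [lra | apply: r1; lra | apply: s1; lra].
- case/eqP: npp'; apply/ffunP => i.
  case: (coord i) => [[_ _ <-]//|].
  case=> [[[F [G H]]|[F G]|[F G]]|[F G]|[F G]|[[F G]|[F G]]] //; exfalso;
    first [lra | apply: r1; lra | apply: s1; lra].
Qed.

(** Here v = 2p - q, which is congruent to 2(p + q) mod 3. *)
Lemma on_line1_reduces_to (R : realType) (k : nat) (v : 'rV[R]_k) p q :
  on_line v p q 1 -> reduces_to v (third p q).
Proof.
move=> vpq i; exists (((2 * p i)%:Z - (q i)%:Z - (third p q i)%:Z) %/ 3)%Z.
have {vpq} := vpq i.
have E : 3 * (((2 * p i)%:Z - (q i)%:Z - (third p q i)%:Z) %/ 3)%Z =
    (2 * p i)%:Z - (q i)%:Z - (third p q i)%:Z.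
  rewrite third_val; case: (p i) => a a3; case: (q i) => b b3 /=; lia.
move/(congr1 (fun z : int => z%:~R : R)): E; rewrite !(rmorphM, rmorphB) /= => E.
rewrite E mul1r => ->; rewrite -!pmulrn natrM; ring.
Qed.

(** By [crossing_ratio], [v] has ratio 1 on one of the two lines, hence is integral. *)
Lemma reduces_to_vertex (R : realType) (k : nat) (a v b : 'rV[R]_k) p q p' q' :
    (forall g, v != grid_point R g) ->
    p \in edge_points a v -> q \in edge_points a v -> p != q ->
    p' \in edge_points v b -> q' \in edge_points v b -> p' != q' ->
    p != p' -> p != q' -> q != p' -> q != q' ->
  exists g, reduces_to v g.
Proof.
rewrite [edge_points a v]edge_pointsC.
move=> nv Hp Hq npq Hp' Hq' npq' npp' npq'' nqp' nqq'.
have [r r0 vpq] := ray_of_edge_points nv Hp Hq npq.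
have [s s0 vpq'] := ray_of_edge_points nv Hp' Hq' npq'.
(* Serves the four choices of the nearer point on each ray. *)
have wlg x y z t : on_line v x y r -> on_line v z t s ->
    x != y -> x != z -> x != t -> y != z -> y != t -> exists g, reduces_to v g.
  move=> vxy vzt nxy nxz nxt nyz nyt.
  have [E|E] := crossing_ratio r0 s0 vxy vzt nxy nxz nxt nyz nyt; rewrite {}E in vxy vzt.
    by exists (third x y); apply: on_line1_reduces_to.
  by exists (third z t); apply: on_line1_reduces_to.
case: vpq => vpq; case: vpq' => vpq'; apply: (wlg _ _ _ _ vpq vpq') => //;
  by rewrite eq_sym.
Qed.

(** Three grid points on an edge form a whole line of F_3^k, which contains the reduction of an
    end. *)
Lemma reduction_mem_edge (R : realType) (k : nat) (v b : 'rV[R]_k) g :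
  reduces_to v g -> (2 < #|edge_points v b|)%N -> g \in edge_points v b.
Proof.
move=> vg /edge_points3[p [q [npq Hp Hq Hx]]].
have [r vpq] := on_line_of_edge_points Hp Hq npq.
by case: (reduces_to_on_line vg npq vpq) => ->.
Qed.

(** Both reductions lie on the line {p, q, [third p q]}; as [g'] is not on the edge, it is
    [third p q]. *)
Lemma reduction_propagates (R : realType) (k : nat) (u v : 'rV[R]_k) g g' p q :
    reduces_to u g -> reduces_to v g' ->
    p \in edge_points u v -> q \in edge_points u v -> p != q ->
    g' \notin edge_points u v ->
  g = g' \/ g \in edge_points u v.
Proof.
move=> ug vg' Hp Hq npq g'N.
have [r upq] := on_line_of_edge_points Hp Hq npq.
have [s vpq] : exists s, on_line v p q s.
  by apply: (@on_line_of_edge_points _ _ _ u) => //; rewrite edge_pointsC.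
have {}vg' : g' = third p q.
  by case: (reduces_to_on_line vg' npq vpq) => // E; rewrite E ?Hp ?Hq in g'N.
case: (reduces_to_on_line ug npq upq) => ->; [by right | by right | by left].
Qed.

(** * New points and the separation of full edges *)

(** Counting a grid point only at the first edge that covers it makes these sets disjoint. *)
Definition new_points (R : realType) (k : nat) (V : nat -> 'rV[R]_k) (l : nat) :
    {set {ffun 'I_k -> 'I_3}} :=
  edge_points (V l) (V l.+1) :\:
    \bigcup_(l' < l) edge_points (V l') (V l'.+1).

Lemma new_points_sub (R : realType) (k : nat) (V : nat -> 'rV[R]_k) l :
  new_points V l \subset edge_points (V l) (V l.+1).
Proof. exact: finset.subsetDl. Qed.

Lemma new_points_notin (R : realType) (k : nat) (V : nat -> 'rV[R]_k) l l' f :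
  (l < l')%N -> f \in new_points V l' -> f \notin edge_points (V l) (V l.+1).
Proof.
move=> ll'; rewrite finset.in_setD => /andP[fN _]; apply: contraNN fN => fl.
by apply/finset.bigcupP; exists (Ordinal ll').
Qed.

Lemma new_pointsT (R : realType) (k : nat) (V : nat -> 'rV[R]_k) l :
  #|edge_points (V l) (V l.+1)| = #|new_points V l| ->
  new_points V l = edge_points (V l) (V l.+1).
Proof. by move=> E; apply/eqP; rewrite finset.eqEcard new_points_sub E leqnn. Qed.

Lemma vertex_notin_grid (R : realType) (k : nat) (V : nat -> 'rV[R]_k) l :
    new_points V l.+1 = edge_points (V l.+1) (V l.+2) ->
  forall g, V l.+1 != grid_point R g.
Proof.
move=> newT g; apply/eqP => Vg.
have gin : g \in new_points V l.+1.
  rewrite newT; apply/edge_pointsP; exists 0; split=> // i.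
  by rewrite Vg mxE; ring.
have /negP := new_points_notin (ltnSn l) gin; apply.
apply/edge_pointsP; exists 1; split=> // i.
by rewrite Vg mxE; ring.
Qed.

Lemma full_edges_separated (R : realType) (k : nat) (V : nat -> 'rV[R]_k) i j :
    (i < j)%N -> #|new_points V i| = 3%N -> #|new_points V j| = 3%N ->
  exists2 l, (i < l < j)%N & (#|new_points V l| <= 1)%N.
Proof.
move=> ij Ni Nj; apply: contrapT => none.
have N2 l : (i <= l < j)%N -> (1 < #|new_points V l|)%N.
  rewrite leq_eqVlt => /andP[/orP[/eqP <- _|il lj]]; first by rewrite Ni.
  by rewrite ltnNge; apply/negP => le1; apply: none; exists l; rewrite ?il.
have edge3 l : #|new_points V l| = 3%N -> new_points V l = edge_points (V l) (V l.+1).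
  move=> N3; apply: new_pointsT; apply/eqP; rewrite eqn_leq.
  by rewrite (subset_leq_card (new_points_sub V l)) N3 card_edge_points.
(* Invariant, walking backwards from [j]: all points of the edge are new, there are at least two,
   and its first vertex reduces to a point first covered by this edge or a later one. *)
have key d : (d < j - i)%N ->
    [/\ new_points V (j - d)%N = edge_points (V (j - d)%N) (V (j - d).+1%N),
        (1 < #|new_points V (j - d)%N|)%N &
        exists g l, [/\ reduces_to (V (j - d)%N) g, (j - d <= l)%N & g \in new_points V l]].
  (* Both edges at the vertex have two new points, and no new point of the second lies on the
     first. *)
  have vertex l : (i <= l < j)%N ->
      new_points V l.+1 = edge_points (V l.+1) (V l.+2) ->
      (1 < #|new_points V l.+1|)%N -> exists g, reduces_to (V l.+1) g.
    move=> il newT /card_gt1P[p' [q' [Hp' Hq' npq']]].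
    have /card_gt1P[p [q [Hp Hq npq]]] := N2 _ il.
    have sub := fintype.subsetP (new_points_sub V _).
    have dif f f' : f \in new_points V l -> f' \in new_points V l.+1 -> f != f'.
      move=> fl fl'; apply: contraTneq (sub _ _ fl) => ->.
      exact: new_points_notin fl'.
    apply: (reduces_to_vertex (vertex_notin_grid newT) (sub _ _ Hp) (sub _ _ Hq) npq
      (sub _ _ Hp') (sub _ _ Hq') npq'); exact: dif.
  elim: d => [|d IH] dlt.
    rewrite subn0; have newT := edge3 _ Nj; split=> //; first by rewrite Nj.
    have [g Vg] : exists g, reduces_to (V j) g.
      have -> : j = j.-1.+1 by lia.
      by apply: vertex; [lia | rewrite prednK //; lia | rewrite prednK ?Nj //; lia].
    exists g, j; split=> //; rewrite newT; apply: reduction_mem_edge Vg _.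
    by rewrite -newT Nj.
  have [newT gt1 [g [l [Vg jl gl]]]] := IH (ltnW dlt).
  set m := (j - d.+1)%N.
  have Em : (j - d)%N = m.+1 by rewrite /m; lia.
  rewrite Em in newT gt1 Vg jl.
  have im : (i < m < j)%N by rewrite /m; lia.
  have gN : g \notin edge_points (V m) (V m.+1) by apply: new_points_notin gl.
  (* With three grid points, edge [m] would contain [g], which is first covered later; so its points
     are just its two new ones. *)
  have le2 : (#|edge_points (V m) (V m.+1)| <= 2)%N.
    rewrite leqNgt; apply: contraNN gN; rewrite edge_pointsC.
    exact: reduction_mem_edge.
  have gt1m : (1 < #|new_points V m|)%N by apply: N2; lia.
  have newTm : new_points V m = edge_points (V m) (V m.+1).
    apply: new_pointsT; have := subset_leq_card (new_points_sub V m); lia.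
  split=> //.
  have [g' Vg'] : exists g', reduces_to (V m) g'.
    have E : m = m.-1.+1 by lia.
    by rewrite E; apply: vertex; [lia | rewrite -E | rewrite -E].
  have /card_gt1P[p [q [Hp Hq npq]]] := gt1m; rewrite newTm in Hp Hq.
  (* Either the reduction stays [g], or [g'] lies on edge [m] and is first covered there. *)
  have [E|g'm] := reduction_propagates Vg' Vg Hp Hq npq gN.
    by exists g, l; rewrite E in Vg' *; split=> //; apply: ltnW.
  by exists g', m; split=> //; rewrite newTm.
(* [V i.+1] is also the end of the full edge [i], which then contains a point first covered
   later. *)
have [|_ _ [g [l [Vg il gl]]]] := key (j - i.+1)%N; first by lia.
have E : (j - (j - i.+1))%N = i.+1 by lia.
rewrite {}E in Vg il.
have /negP := new_points_notin il gl; apply.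
rewrite edge_pointsC; apply: reduction_mem_edge Vg _.
by rewrite edge_pointsC -edge3 ?Ni.
Qed.

(** * Counting: the lower bound *)

(** The induction is strengthened by the case of equality: the bound is attained only if some 3 has
    no value below 2 after it, and then the next term cannot be 3. *)
Lemma sum_le_of_separated (c : nat -> nat) :
    (forall l, (c l <= 3)%N) ->
    (forall i j, (i < j)%N -> c i = 3%N -> c j = 3%N ->
       exists2 l, (i < l < j)%N & (c l <= 1)%N) ->
  forall m, (\sum_(l < m) c l <= (2 * m).+1)%N.
Proof.
move=> c3 sep m.
suff [] : (\sum_(l < m) c l <= (2 * m).+1)%N /\
    (\sum_(l < m) c l = (2 * m).+1 ->
     exists2 i, (i < m)%N & c i = 3%N /\ forall l, (i < l < m)%N -> (1 < c l)%N) by [].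
elim: m => [|m [IHle IHeq]]; first by rewrite big_ord0.
rewrite big_ord_recr /=; move: (\sum_(l < m) c l)%N IHle IHeq => S IHle IHeq.
have [E|nE] := eqVneq S (2 * m).+1; last first.
  split; first by have := c3 m; lia.
  move=> E; exists m => //; split; first by have := c3 m; lia.
  by move=> l; lia.
have [i im [ci gt1]] := IHeq E.
have cm : (c m <= 2)%N.
  rewrite leqNgt; apply/negP => cm3.
  have [|l il cl] := sep i m im ci; first by have := c3 m; lia.
  by have := gt1 l il; lia.
split; first by lia.
move=> E'; exists i; first exact: ltnW.
split=> // l /andP[il]; rewrite ltnS leq_eqVlt => /orP[/eqP ->|lm]; first by lia.
by apply: gt1; rewrite il.
Qed.

Lemma has_covering_trailP (R : realType) (n k m : nat) :
  has_covering_trail R n k m <->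
  exists V : nat -> 'rV[R]_k, forall f : {ffun 'I_k -> 'I_n},
    exists2 l, (l < m)%N & segment (V l) (V l.+1) (\row_j (f j)%:R).
Proof.
split=> [[V cov]|[V cov]].
  exists (fun l => V (inord l)) => f.
  have [|l _ Hl] := cov (\row_j (f j)%:R); first by exists f.
  exists l => //; congr (segment (V _) (V _) _) : Hl; apply/ord_inj.
    by rewrite inordK // ltnS ltnW.
  by rewrite inordK // ltnS.
exists (fun l => V l) => _ [f _ <-]; have [l lm Hl] := cov f.
by exists (Ordinal lm).
Qed.

Lemma covering_trail_length (R : realType) (k m : nat) :
  has_covering_trail R 3 k m -> (3 ^ k <= (2 * m).+1)%N.
Proof.
move=> /has_covering_trailP[V cov].
pose c l := #|new_points V l|.
have c3 l : (c l <= 3)%N.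
  exact: leq_trans (subset_leq_card (new_points_sub V l)) (card_edge_points _ _).
apply: leq_trans (sum_le_of_separated c3 _ m); last first.
  by move=> i j; apply: full_edges_separated.
suff E n : #|\bigcup_(l < n) edge_points (V l) (V l.+1)| = (\sum_(l < n) c l)%N.
  rewrite -E; suff -> : \bigcup_(l < m) edge_points (V l) (V l.+1) = [set: _]%SET.
    by rewrite finset.cardsT card_ffun !card_ord.
  apply/finset.setP => f; rewrite finset.in_setT; have [l lm Hl] := cov f.
  apply/finset.bigcupP; exists (Ordinal lm) => //=.
  by rewrite inE; apply/asboolP.
elim: n => [|n IH]; first by rewrite !big_ord0 finset.cards0.
rewrite !big_ord_recr /= -IH /c /new_points.
move: (\bigcup_(_ < n) _) => U.
by rewrite -[LHS](cardsID U) finset.setUK finset.setDUl finset.setDv finset.set0U.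
Qed.

(** * Raising the dimension *)

Definition cons_coord (R : realType) (k : nat) (c : R) (x : 'rV[R]_k) :
  'rV[R]_k.+1 := \row_j oapp (x 0) c (unlift ord0 j).

Lemma segment_cons_coord (R : realType) (k : nat) (c : R) (a b x : 'rV[R]_k) :
  segment a b x -> segment (cons_coord c a) (cons_coord c b) (cons_coord c x).
Proof.
move=> [t t01 <-]; exists t => //; apply/rowP => j; rewrite !mxE.
by case: unliftP => [i _|_] /=; rewrite ?mxE //; ring.
Qed.

(* The layers x_0 = 0, ..., n - 1 are swept by copies of the given trail, every
   other one backwards; consecutive copies are joined by one edge. *)
Lemma has_covering_trailS (R : realType) (n k m : nat) :
  has_covering_trail R n k m -> has_covering_trail R n k.+1 (n * m.+1).-1.
Proof.
move=> /has_covering_trailP[V cov]; apply/has_covering_trailP.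
pose W j := let c := (j %/ m.+1)%N in let i := (j %% m.+1)%N in
  cons_coord c%:R (V (if odd c then m - i else i)%N).
exists W => f; set c := f ord0.
have [l lm Hl] := cov [ffun i => f (lift ord0 i)].
have -> : \row_j (f j)%:R =
    cons_coord c%:R (\row_j ([ffun i => f (lift ord0 i)] j)%:R) :> 'rV[R]_k.+1.
  apply/rowP => j; rewrite !mxE.
  by case: unliftP => [i ->|->] //=; rewrite mxE ffunE.
have WE i : (i <= m)%N ->
    W (c * m.+1 + i)%N = cons_coord c%:R (V (if odd c then m - i else i)%N).
  by move=> im; rewrite /W divnMDl // divn_small // addn0 modnMDl modn_small.
(* Each layer takes [m.+1] vertices; read backwards, edge [l] starts at position [m - l.+1]. *)
exists (c * m.+1 + (if odd c then m - l.+1 else l))%N.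
  have := ltn_ord c; case: ifP => _; nia.
rewrite -addnS !WE; try by case: ifP => _; lia.
case: (odd c); last exact: segment_cons_coord.
apply/segmentC/segment_cons_coord.
by congr (segment (V _) (V _) _) : Hl; lia.
Qed.

(** * A trail in dimension 3 and its iteration *)

(** Its 13 edges attain the lower bound (27 - 1)/2; some vertices lie outside the cube. *)
Definition trail3 : seq (seq int) :=
  [:: [:: 2; -1; 0]; [:: 2; 4; 0]; [:: 2; 0; 2]; [:: 2; 2; 2]; [:: 0; 0; 0];
      [:: 0; 0; 3]; [:: 0; 3; 0]; [:: 0; 0; 0]; [:: 0; 3; 3]; [:: 3; 0; 0];
      [:: 1; 0; 2]; [:: 1; 0; 0]; [:: 1; 3; 0]; [:: 1; -1; 4]].

(** Integer form of the point at parameter [s / d.+1] on edge [l]. Denominators up to 5 suffice, and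
    computation decides the 27 cases. *)
Lemma trail3_covers (a b c : 'I_3) :
  exists l d s : nat, [/\ (l < 13)%N, (s <= d.+1)%N & forall j, (j < 3)%N ->
    d.+1%:Z * (nth 0 [:: a : nat; b : nat; c : nat] j)%:Z =
    (d.+1%:Z - s%:Z) * nth 0 (nth [::] trail3 l) j + s%:Z * nth 0 (nth [::] trail3 l.+1) j].
Proof.
pose ok (g : seq nat) := has (fun l => has (fun d => has (fun s => all (fun j =>
  d.+1%:Z * (nth 0%N g j)%:Z == (d.+1%:Z - s%:Z) * nth 0 (nth [::] trail3 l) j +
    s%:Z * nth 0 (nth [::] trail3 l.+1) j) (iota 0 3)) (iota 0 d.+2)) (iota 0 5)) (iota 0 13).
have /hasP[l + /hasP[d _ /hasP[s + /allP H]]] : ok [:: a : nat; b : nat; c : nat].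
  case: a => [[|[|[|//]]] ?]; case: b => [[|[|[|//]]] ?]; case: c => [[|[|[|//]]] ?];
    vm_compute; reflexivity.
rewrite !mem_iota !add0n => /andP[_ l13] /andP[_ sd]; exists l, d, s; split=> // j j3.
by apply/eqP/H; rewrite mem_iota.
Qed.

Lemma has_covering_trail3 (R : realType) : has_covering_trail R 3 3 13.
Proof.
apply/has_covering_trailP.
exists (fun l => \row_(j < 3) (nth 0 (nth [::] trail3 l) j)%:~R) => f.
have [l [d [s [l13 sd H]]]] := trail3_covers (f (inord 0)) (f (inord 1)) (f (inord 2)).
exists l => //; exists (s%:R / d.+1%:R).
  by rewrite /= in_itv /= divr_ge0 //= ler_pdivrMr ?ltr0n // mul1r ler_nat.
apply/rowP => j; rewrite !mxE.
have -> : (f j : nat) = nth 0%N [:: f (inord 0) : nat; f (inord 1) : nat; f (inord 2) : nat] j.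
  by case: j => [[|[|[|//]]] ?] /=; congr (nat_of_ord (f _)); apply/val_inj; rewrite /= inordK.
move/(congr1 (fun z : int => z%:~R : R)): (H j (ltn_ord j)).
rewrite rmorphD !rmorphM rmorphB /= -!pmulrn.
move: (_%:~R) (_%:~R) => x y E.
have d0 : d.+1%:R != 0 :> R by rewrite pnatr_eq0.
apply: (mulfI d0); rewrite E; field.
by [].
Qed.

(** The length plus one triples at each step, starting from 14. *)
Lemma has_covering_trail_cube (R : realType) (d : nat) :
  has_covering_trail R 3 d.+3 (14 * 3 ^ d).-1.
Proof.
elim: d => [|d IH]; first exact: has_covering_trail3.
have := has_covering_trailS IH; congr (has_covering_trail R _ _ _.-1).
by rewrite expnS prednK ?muln_gt0 ?expn_gt0 //; lia.
Qed.

(** * Bounds on h(3,k) *)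

Lemma h_le (R : realType) (n k m : nat) : has_covering_trail R n k m -> (h R n k <= m)%N.
Proof.
by rewrite /h; case: ex_minnP => x _ xmin cov; apply: xmin; apply/asboolP.
Qed.

Lemma h_covering_trail (R : realType) (n k : nat) : has_covering_trail R n k (h R n k).
Proof. by rewrite /h; case: ex_minnP => x /asboolP. Qed.

Unset Implicit Arguments.

Theorem mainTheorem3 (R : realType) (k : nat) (hk : (8 <= k)%N) :
  k%:R / (k%:R - 1) * 3 ^+ (k - 1) + 3 ^+ (k - 2) <= (h R 3 k)%:R :> R /\
  (h R 3 k)%:R <= k%:R / (k%:R - 1) * 3 ^+ (k - 1) + 3 `^ (k%:R - 3 / 2) :> R.
Proof.
have k1 : 7 <= k%:R - 1 :> R by have := hk; rewrite -(ler_nat R); lra.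
have frac : k%:R / (k%:R - 1) = 1 + (k%:R - 1)^-1 :> R by field; lra.
have inv0 : 0 < (k%:R - 1)^-1 :> R by rewrite invr_gt0; lra.
have inv7 : (k%:R - 1)^-1 <= 7^-1 :> R by rewrite lef_pV2 ?posrE; lra.
have X1 : 3 ^+ (k - 1) = 3 * 3 ^+ (k - 2) :> R by rewrite -exprS; congr (_ ^+ _); lia.
have X9 : 3 ^+ k = 9 * 3 ^+ (k - 2) :> R.
  by rewrite -[9]/(3 * 3)%:R natrM -mulrA -!exprS; congr (_ ^+ _); lia.
have X27 : 27 <= 3 ^+ (k - 2) :> R.
  by rewrite -[27]/(3 ^ 3)%:R natrX ler_eXn2l // ?ltr1n //; lia.
rewrite frac X1; split.
  have := covering_trail_length (h_covering_trail R 3 k).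
  rewrite -(ler_nat R) natrX X9 -[(2 * _).+1]addn1 natrD natrM => len.
  (* With X = 3^(k-2), the left side is at most 4X + 3X/7 = 31X/7, which is below (9X - 1)/2 as X >=
     27. *)
  by move: (_ ^+ (k - 2)) X27 len => X X27 len; nra.
have : (h R 3 k <= 14 * 3 ^ (k - 3))%N.
  apply: leq_trans (leq_pred _); apply: h_le.
  by have := has_covering_trail_cube R (k - 3); congr has_covering_trail; lia.
rewrite -(ler_nat R) natrM natrX => hle.
have X3 : 3 ^+ (k - 2) = 3 * 3 ^+ (k - 3) :> R by rewrite -exprS; congr (_ ^+ _); lia.
have -> : k%:R - 3 / 2 = (k - 2)%:R + 2^-1 :> R by rewrite natrB ?(leq_trans _ hk) //; field.
rewrite powRD; last by rewrite pnatr_eq0 implybT.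
rewrite powR_mulrn // powR12_sqrt //.
(* With Y = 3^(k-3), the right side is at least 9Y + 3Y sqrt 3, hence at least 14Y. *)
have sqrt3 : 5 / 3 <= Num.sqrt 3 :> R by rewrite -[leLHS]ger0_norm -?sqrtr_sqr ?ler_wsqrtr; lra.
move: (Num.sqrt 3) (_ ^+ (k - 3)) X3 hle sqrt3 X27 => s Y -> hle sqrt3 X27.
nra.
Qed.
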